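(* Let $P$ and $Q$ be distributions over a finite set $U$. Suppose we have sample access to $P$ and $Q$, and can make calls to two circuits $\mathcal C_P$ and $\mathcal C_Q$ which implement $(\beta,\gamma)$-EVAL approximators for $P$ and $Q$ respectively, and let $T$ be the maximum running time of any call to $\mathcal C_P$ or $\mathcal C_Q$. Then for any $\epsilon,\delta>0$, there is an algorithm which, with probability at least $1-\delta$, approximates $d_{TV}(P,Q)$ up to an additive error $\frac{2\gamma}{1-\gamma}+3\beta+\epsilon$, using $O(\epsilon^{-2}\log\delta^{-1})$ samples from $P$ and $O(\epsilon^{-2}\log\delta^{-1}\cdot T)$ running time.
   Context: For a distribution $P$ over a finite set $U$, a function $E_P:U\to[0,1]$ is a $(\beta,\gamma)$-EVAL approximator for $P$ if there exists a distribution $\hat P$ over $U$ such that (i) $d_{TV}(P,\hat P)\le\beta$, and (ii) for all $x\in U$, $(1-\gamma)\hat P(x)\le E_P(x)\le(1+\gamma)\hat P(x)$. Here $d_{TV}$ denotes total variation distance and $\hat P(x)=\Pr_{X\sim\hat P}[X=x]$. *)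

(* Defs.v *)
From mathcomp Require Import all_boot all_order all_algebra.
From mathcomp Require Import reals exp.

Set Implicit Arguments.
Unset Strict Implicit.
Unset Printing Implicit Defensive.

Import Order.TTheory GRing.Theory Num.Theory.
Local Open Scope ring_scope.

Record fdist (R : realType) (U : finType) := FDist {
  pmf :> U -> R;
  pmf_ge0 : forall x, 0 <= pmf x;
  pmf_sum1 : \sum_x pmf x = 1 }.

Definition dTV (R : realType) (U : finType) (P Q : fdist R U) : R :=
  2^-1 * \sum_x `|P x - Q x|.

Definition eval_approximator (R : realType) (U : finType) (beta gamma : R)
    (P : fdist R U) (E : U -> R) : Prop :=
  (forall x, 0 <= E x <= 1) /\
  exists Phat : fdist R U,
    dTV P Phat <= beta /\
    forall x, (1 - gamma) * Phat x <= E x <= (1 + gamma) * Phat x.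

(* A circuit is seen by its caller as a black box: a call on x returns
   [cval x] and takes [ctime x] units of time, at least one. *)
Record circuit (R : realType) (U : finType) := Circuit {
  cval : U -> R;
  ctime : U -> nat;
  ctime_gt0 : forall x, (0 < ctime x)%N }.

Definition max_time (R : realType) (U : finType) (CP CQ : circuit R U) : nat :=
  \max_(x : U) maxn (ctime CP x) (ctime CQ x).

(* Algorithms are programs of a unit-cost real RAM with two register banks,
   one holding real numbers and one holding elements of the universe. The
   latter can only be filled by sampling and used in circuit calls. A program
   is a finite text whose only constants are natural numbers; it mentions
   neither the universe, nor the distributions, nor the circuits. *)
Inductive instr :=
| Const (i n : nat)          (* r_i := n *)
| Add (i j k : nat)          (* r_i := r_j + r_k *)
| Sub (i j k : nat)
| Mul (i j k : nat)
| Div (i j k : nat)          (* fails if r_k = 0 *)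
| JumpLt (i j l : nat)       (* if r_i < r_j then go to line l *)
| SampleP (a : nat)          (* u_a := a fresh sample from P *)
| SampleQ (a : nat)
| CallP (i a : nat)          (* r_i := C_P(u_a), fails if u_a is unset *)
| CallQ (i a : nat)
| Output (i : nat).          (* halt with answer r_i *)

Definition program := seq instr.

Section Semantics.
Variables (R : realType) (U : finType).
Variables (P Q : fdist R U) (CP CQ : circuit R U).

Record state := State {
  pc : nat;
  reg : nat -> R;
  item : nat -> option U;
  drawsP : nat;
  clock : nat }.

Definition init : state := State 0 (fun=> 0) (fun=> None) 0 0.

Record outcome := Outcome { answer : R; samplesP : nat; runtime : nat }.

Inductive transition :=
| Move of state
| Draw of fdist R U & (U -> state)
| Halt of outcome
| Fail.

Definition set_reg (s : state) (i : nat) (v : R) (t : nat) : state :=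
  State (pc s).+1 [eta reg s with i |-> v] (item s) (drawsP s) (clock s + t).

Definition set_item (s : state) (a : nat) (x : U) (d : nat) : state :=
  State (pc s).+1 (reg s) [eta item s with a |-> Some x]
    (drawsP s + d) (clock s).+1.

Definition goto (s : state) (l : nat) : state :=
  State l (reg s) (item s) (drawsP s) (clock s).+1.

Definition call (C : circuit R U) (s : state) (i a : nat) : transition :=
  if item s a is Some x then Move (set_reg s i (cval C x) (ctime C x).+1)
  else Fail.

Definition step (A : program) (s : state) : transition :=
  match onth A (pc s) with
  | Some (Const i n) => Move (set_reg s i n%:R 1)
  | Some (Add i j k) => Move (set_reg s i (reg s j + reg s k) 1)
  | Some (Sub i j k) => Move (set_reg s i (reg s j - reg s k) 1)
  | Some (Mul i j k) => Move (set_reg s i (reg s j * reg s k) 1)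
  | Some (Div i j k) =>
      if reg s k == 0 then Fail else Move (set_reg s i (reg s j / reg s k) 1)
  | Some (JumpLt i j l) =>
      Move (goto s (if reg s i < reg s j then l else (pc s).+1))
  | Some (SampleP a) => Draw P (fun x => set_item s a x 1)
  | Some (SampleQ a) => Draw Q (fun x => set_item s a x 0)
  | Some (CallP i a) => call CP s i a
  | Some (CallQ i a) => call CQ s i a
  | Some (Output i) => Halt (Outcome (reg s i) (drawsP s) (clock s).+1)
  | None => Fail
  end.

(* Probability that the run of A from s halts within n steps with an outcome
   in E (successive samples are independent). It is nondecreasing in n. *)
Fixpoint Pr_from (A : program) (n : nat) (s : state) (E : pred outcome) : R :=
  if n is n'.+1 then
    match step A s with
    | Move s' => Pr_from A n' s' E
    | Draw D k => \sum_x D x * Pr_from A n' (k x) E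
    | Halt o => (E o)%:R
    | Fail => 0
    end
  else 0.

Definition Pr (A : program) (n : nat) (E : pred outcome) : R :=
  Pr_from A n init E.

End Semantics.

(* eps^-2 * log(1/delta), with eps capped at 1 and delta at 1/2: the caps only
   keep the rate away from 0 (log(1/delta) <= 0 for delta >= 1), where no
   algorithm could meet the O-bounds since merely halting takes a step. *)
Definition rate (R : realType) (eps delta : R) : R :=
  (Num.min eps 1) ^- 2 * ln (Num.min delta 2^-1)^-1.

(* Main.v *)
(* Draw X_1, ..., X_m from P and average the gains max(0, 1 - E_Q(X_i) / E_P(X_i)).
   Up to the approximation, the mean of the gain is dTV P Q, since
   dTV P Q = E_P[max(0, 1 - Q(X) / P(X))]: passing to the approximating
   distributions costs 2 beta in the distance and beta in the mean, and the
   multiplicative errors of E_P and E_Q cost 2 gamma / (1 - gamma). A Chernoff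
   bound then makes m = O(eps^-2 log (1 / delta)) samples sufficient. *)
Require Import Defs.
From mathcomp Require Import all_boot all_order all_algebra.
From mathcomp Require Import reals exp.
From mathcomp Require Import sequences ring lra zify.

Set Implicit Arguments.
Unset Strict Implicit.
Unset Printing Implicit Defensive.

Import Order.TTheory GRing.Theory Num.Theory.
Local Open Scope ring_scope.

(** * Total variation distance and the bias of the mean gain *)

Lemma dTV_pos_part (R : realType) (U : finType) (P Q : fdist R U) :
  dTV P Q = \sum_x Num.max 0 (P x - Q x).
Proof.
(* In this form the terms [- P x + Q x] cancel after summation, both masses being 1. *)
have dist x : `|P x - Q x| = 2 * Num.max 0 (P x - Q x) - P x + Q x.
  by case: (leP 0 (P x - Q x)) => h; [rewrite ger0_norm|rewrite ltr0_norm] => //; lra.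
rewrite /dTV (eq_bigr _ (fun x _ => dist x)) big_split sumrB /= -mulr_sumr !pmf_sum1.
by lra.
Qed.

Lemma dTV_perturb (R : realType) (U : finType) (P Q P' Q' : fdist R U) :
  `|dTV P' Q' - dTV P Q| <= dTV P P' + dTV Q Q'.
Proof.
rewrite /dTV -mulrBr -mulrDr normrM ger0_norm ?invr_ge0 //.
rewrite ler_wpM2l ?invr_ge0 // -sumrB -big_split /=.
apply: le_trans (ler_norm_sum _ _ _) _; apply: ler_sum => x _.
apply: le_trans (ler_dist_dist _ _) _.
rewrite [`|P x - _|]distrC.
have -> : P' x - Q' x - (P x - Q x) = (P' x - P x) + (Q x - Q' x) by ring.
exact: ler_normD.
Qed.

(* Centring [f] at [1/2] is harmless since both masses are 1, and it saves a factor 2. *)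
Lemma mean_dTV (R : realType) (U : finType) (P Q : fdist R U) (f : U -> R) :
  (forall x, 0 <= f x <= 1) ->
  `|\sum_x P x * f x - \sum_x Q x * f x| <= dTV P Q.
Proof.
move=> f01.
have -> : \sum_x P x * f x - \sum_x Q x * f x =
          \sum_x (P x - Q x) * (f x - 2^-1).
  rewrite [RHS](eq_bigr (fun x => P x * f x - Q x * f x - 2^-1 * P x + 2^-1 * Q x));
    last by move=> x _; ring.
  rewrite big_split !sumrB /= -!mulr_sumr !pmf_sum1; lra.
apply: le_trans (ler_norm_sum _ _ _) _; rewrite /dTV mulr_sumr.
apply: ler_sum => x _; rewrite normrM mulrC ler_wpM2r //.
by have := f01 x; rewrite ler_norml; lra.
Qed.

(** For [gamma < 0] the lower bound exceeds the upper one wherever [D x > 0], so [D] would have mass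
    0. *)
Lemma eval_approximator_gamma_ge0 (R : realType) (U : finType)
    (beta gamma : R) (P : fdist R U) (E : U -> R) :
  eval_approximator beta gamma P E -> 0 <= gamma.
Proof.
move=> [_ [D [_ DE]]]; rewrite leNgt; apply/negP => gamma_lt0.
have D0 x : D x = 0.
  by have /andP[h1 h2] := DE x; have h3 := pmf_ge0 D x; nra.
by have := pmf_sum1 D; rewrite big1 // => /esym/eqP; rewrite oner_eq0.
Qed.

(** Testing [b < a] first mirrors the program: for [b >= 0] it forces [a > 0], so the machine never
    divides by 0. *)
Definition gain (R : realType) (a b : R) : R := if b < a then 1 - b / a else 0.

Lemma gain_itv (R : realType) (a b : R) : 0 <= a -> 0 <= b -> 0 <= gain a b <= 1.
Proof.
move=> a0 b0; rewrite /gain; case: ifP => ba; last by rewrite lexx ler01.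
have a_gt0 : 0 < a by exact: le_lt_trans ba.
rewrite subr_ge0 ler_pdivrMr // mul1r (ltW ba) /=.
by rewrite gerBl divr_ge0.
Qed.

(** If [b < a], then [p * gain a b = p - w], where [w = p * (b / a) < p] stands for [q]: each of [w]
    and [q] is at most [(1 + gamma) / (1 - gamma)] times the other. If [a <= b], the gain is 0, and
    [(1 - gamma) * p <= (1 + gamma) * q] keeps [p - q] small. *)
Lemma gain_error (R : realType) (gamma p q a b : R) :
  0 <= gamma < 1 -> 0 <= p -> 0 <= q ->
  (1 - gamma) * p <= a <= (1 + gamma) * p ->
  (1 - gamma) * q <= b <= (1 + gamma) * q ->
  `|p * gain a b - Num.max 0 (p - q)| <= 2 * gamma / (1 - gamma) * p.
Proof.
move=> /andP[g0 g1] p0 q0 /andP[a1 a2] /andP[b1 b2].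
have d0 : 0 < 1 - gamma by lra.
have [->|pn0] := eqVneq p 0.
  by rewrite mul0r mulr0 sub0r normrN max_l ?normr0 // sub0r oppr_le0.
have p_gt0 : 0 < p by rewrite lt_neqAle eq_sym pn0.
have a_gt0 : 0 < a by nra.
rewrite mulrAC ler_pdivlMr // /gain.
have gp : 0 <= gamma * p by rewrite mulr_ge0.
have gq : 0 <= gamma * q by rewrite mulr_ge0.
have [ba|ab] := ltP b a.
  set w := p * (b / a).
  have wa : w * a = p * b by rewrite /w; field; rewrite gt_eqF.
  have wp : w < p by rewrite /w gtr_pMr // ltr_pdivrMr ?mul1r.
  have b0 : 0 <= b by nra.
  have w0 : 0 <= w by rewrite mulr_ge0 // divr_ge0 // ltW.
  (* Both comparisons of [w] with [q] are multiplied by [p] and pass through [w * a = p * b]. *)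
  have w1 : (1 - gamma) * q <= (1 + gamma) * w.
    rewrite -(ler_pM2l p_gt0); apply: (@le_trans _ _ (p * b)); first by nra.
    by rewrite -wa; nra.
  have w2 : (1 - gamma) * w <= (1 + gamma) * q.
    rewrite -(ler_pM2l p_gt0); apply: (@le_trans _ _ (p * b)); last by nra.
    by rewrite -wa; nra.
  have -> : p * (1 - b / a) = p - w by rewrite /w; ring.
  have gw : gamma * w <= gamma * p by rewrite ler_wpM2l // ltW.
  rewrite -[X in _ * X <= _](gtr0_norm d0) -normrM ler_norml.
  case: (leP 0 (p - q)) => pq.
    have gqp : gamma * q <= gamma * p by rewrite ler_wpM2l //; lra.
    by apply/andP; split; lra.
  have : gamma * p <= gamma * q by rewrite ler_wpM2l //; lra.
  by move=> gpq; apply/andP; split; nra.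
rewrite mulr0 sub0r normrN ger0_norm ?le_max ?lexx //.
case: (leP 0 (p - q)) => pq; last by rewrite mul0r; lra.
have gqp : gamma * q <= gamma * p by rewrite ler_wpM2l //; lra.
by lra.
Qed.

Lemma gain_bias (R : realType) (U : finType) (P Q : fdist R U)
    (EP EQ : U -> R) (beta gamma : R) :
  gamma < 1 ->
  eval_approximator beta gamma P EP -> eval_approximator beta gamma Q EQ ->
  `|\sum_x P x * gain (EP x) (EQ x) - dTV P Q|
     <= 2 * gamma / (1 - gamma) + 3 * beta.
Proof.
move=> g1 hP hQ; have g0 := eval_approximator_gamma_ge0 hP.
case: hP => [EP01 [P' [PP' P'E]]]; case: hQ => [EQ01 [Q' [QQ' Q'E]]].
pose f x := gain (EP x) (EQ x).
have f01 x : 0 <= f x <= 1.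
  by have /andP[? _] := EP01 x; have /andP[? _] := EQ01 x; exact: gain_itv.
have h1 : `|\sum_x P x * f x - \sum_x P' x * f x| <= beta.
  exact: le_trans (mean_dTV _ _ f01) PP'.
(* The pointwise error is relative to [P' x], hence the mean under [P'], whose mass 1 leaves the
   bare factor. *)
have h2 : `|\sum_x P' x * f x - dTV P' Q'| <= 2 * gamma / (1 - gamma).
  have -> : 2 * gamma / (1 - gamma) = \sum_x 2 * gamma / (1 - gamma) * P' x.
    by rewrite -mulr_sumr pmf_sum1 mulr1.
  rewrite dTV_pos_part -sumrB.
  apply: le_trans (ler_norm_sum _ _ _) _; apply: ler_sum => x _.
  by apply: gain_error; rewrite ?g0 ?pmf_ge0.
have h3 : `|dTV P' Q' - dTV P Q| <= beta + beta.
  exact: le_trans (dTV_perturb _ _ _ _) (lerD PP' QQ').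
apply: le_trans (ler_distD (\sum_x P' x * f x) _ _) _.
have := ler_distD (dTV P' Q') (\sum_x P' x * f x) (dTV P Q).
by move: h1 h2 h3; rewrite /f; lra.
Qed.

(** * Chernoff bound for sums of i.i.d. variables *)

(* Expectation of [g (s + f X_1 + ... + f X_k)], the X_i being i.i.d. from [P]. *)
Fixpoint walk (R : realType) (U : finType) (P : fdist R U) (f : U -> R)
    (k : nat) (g : R -> R) (s : R) : R :=
  if k is k'.+1 then \sum_x P x * walk P f k' g (s + f x) else g s.

Section Walk.
Variables (R : realType) (U : finType) (P : fdist R U) (f : U -> R).

Lemma le_walk k (g h : R -> R) s :
  (forall t, g t <= h t) -> walk P f k g s <= walk P f k h s.
Proof.
move=> gh; elim: k s => [|k IH] s //=.
by apply: ler_sum => x _; rewrite ler_wpM2l ?pmf_ge0.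
Qed.

Lemma walk1 k s : walk P f k (fun=> 1) s = 1.
Proof.
elim: k s => [|k IH] s //=; rewrite -[RHS](pmf_sum1 P).
by apply: eq_bigr => x _; rewrite IH mulr1.
Qed.

Lemma walkD k (g h : R -> R) s :
  walk P f k (fun t => g t + h t) s = walk P f k g s + walk P f k h s.
Proof.
elim: k s => [|k IH] s //=; rewrite -big_split /=.
by apply: eq_bigr => x _; rewrite IH mulrDr.
Qed.

Lemma walkZ k (a : R) (g : R -> R) s :
  walk P f k (fun t => a * g t) s = a * walk P f k g s.
Proof.
elim: k s => [|k IH] s //=; rewrite mulr_sumr.
by apply: eq_bigr => x _; rewrite IH mulrCA.
Qed.

Lemma walk_expR k (l s : R) :
  walk P f k (fun t => expR (l * t)) s =
  expR (l * s) * (\sum_x P x * expR (l * f x)) ^+ k.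
Proof.
elim: k s => [|k IH] s /=; first by rewrite expr0 mulr1.
rewrite exprS mulrA mulr_sumr mulr_suml; apply: eq_bigr => x _.
by rewrite IH mulrDr expRD; ring.
Qed.

End Walk.

(** [expR (- x) >= 1 - x] gives [expR x <= (1 - x)^-1], and [(1 + x + 2 * x ^+ 2) * (1 - x) = 1 + x
    ^+ 2 * (1 - 2 * x)]. *)
Lemma expR_le_quadratic (R : realType) (x : R) :
  x <= 2^-1 -> expR x <= 1 + x + 2 * x ^+ 2.
Proof.
move=> x2; have h : 0 < 1 - x by lra.
apply: (@le_trans _ _ (1 - x)^-1).
  rewrite -[x in expR x]opprK expRN lef_pV2 ?posrE ?expR_gt0 //.
  exact: expR_ge1Dx.
rewrite -div1r ler_pdivrMr //.
have : 0 <= x ^+ 2 * (1 - 2 * x) by rewrite mulr_ge0 ?sqr_ge0 //; lra.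
by rewrite !expr2; lra.
Qed.

Section Chernoff.
Variables (R : realType) (U : finType) (P : fdist R U) (f : U -> R).
Hypothesis f01 : forall x, 0 <= f x <= 1.
Let mu := \sum_x P x * f x.

Lemma mean_itv : 0 <= mu <= 1.
Proof.
apply/andP; split.
  by apply: sumr_ge0 => x _; have /andP[? _] := f01 x; rewrite mulr_ge0 ?pmf_ge0.
rewrite -(pmf_sum1 P); apply: ler_sum => x _; have /andP[_ ?] := f01 x.
by rewrite ler_piMr ?pmf_ge0.
Qed.

(** The quadratic bound is applied to [l * (f x - mu)], whose linear term has mean 0; then
    [1 + 2 * l ^+ 2 <= expR (2 * l ^+ 2)]. *)
Lemma mgf_le (l : R) : `|l| <= 2^-1 ->
  \sum_x P x * expR (l * f x) <= expR (l * mu + 2 * l ^+ 2).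
Proof.
move=> l2; have /andP[m0 m1] := mean_itv.
have step x : expR (l * f x) <=
    expR (l * mu) * (1 + l * (f x - mu) + 2 * l ^+ 2).
  rewrite (_ : l * f x = l * mu + l * (f x - mu)); last by ring.
  rewrite expRD ler_wpM2l ?expR_ge0 //.
  have fm : `|f x - mu| <= 1 by have := f01 x; rewrite ler_norml; lra.
  have lfm : `|l * (f x - mu)| <= 2^-1.
    by rewrite normrM -[leRHS]mulr1 ler_pM.
  apply: le_trans (expR_le_quadratic (le_trans (ler_norm _) lfm)) _.
  rewrite lerD2l ler_wpM2l // exprMn ler_piMr ?sqr_ge0 //.
  by rewrite -(@real_normK _ (f x - mu)) ?num_real // expr_le1.
apply: (@le_trans _ _
    (\sum_x P x * (expR (l * mu) * (1 + l * (f x - mu) + 2 * l ^+ 2)))).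
  by apply: ler_sum => x _; rewrite ler_wpM2l ?pmf_ge0.
rewrite (eq_bigr (fun x => expR (l * mu) * (1 - l * mu + 2 * l ^+ 2) * P x
   + expR (l * mu) * l * (P x * f x))); last by move=> x _; ring.
rewrite big_split /= -!mulr_sumr pmf_sum1 -/mu.
rewrite [leLHS](_ : _ = expR (l * mu) * (1 + 2 * l ^+ 2)); last by ring.
by rewrite expRD ler_wpM2l ?expR_ge0 ?expR_ge1Dx.
Qed.

(** The integrand is at least 1 where [l * (t - k%:R * mu) >= e], so this is Markov's inequality in
    exponential form; the sign of [l] selects the tail. *)
Lemma walk_tail k (l e : R) : `|l| <= 2^-1 ->
  walk P f k (fun t => expR (- (l * (k%:R * mu)) - e) * expR (l * t)) 0
    <= expR (2 * l ^+ 2 * k%:R - e).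
Proof.
move=> l2; rewrite walkZ walk_expR mulr0 expR0 mul1r.
apply: (@le_trans _ _ (expR (- (l * (k%:R * mu)) - e) *
                       expR (l * mu + 2 * l ^+ 2) ^+ k)).
  rewrite ler_wpM2l ?expR_ge0 // lerXn2r ?nnegrE ?expR_ge0 ?mgf_le //.
  by apply: sumr_ge0 => x _; rewrite mulr_ge0 ?pmf_ge0 ?expR_ge0.
by rewrite -expRM_natl -expRD le_eqVlt; apply/orP; left; apply/eqP; congr expR; ring.
Qed.

Lemma walk_concentration k (e : R) : (0 < k)%N -> 0 < e <= 1 ->
  1 - 2 * expR (- (k%:R * e ^+ 2 / 8)) <=
  walk P f k (fun t => (`|t / k%:R - mu| <= e)%R%:R) 0.
Proof.
move=> k0 /andP[e0 e1]; have kR : 0 < k%:R :> R by rewrite ltr0n.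
(* [l = e / 4] minimises [2 * l ^+ 2 * k - l * k * e], with value [- (k * e ^+ 2 / 8)]. *)
pose l := e / 4; pose c := l * (k%:R * e).
pose tail s t := expR (- (s * l * (k%:R * mu)) - c) * expR (s * l * t).
have tail_ge0 s t : 0 <= tail s t by rewrite mulr_ge0 ?expR_ge0.
(* [tail 1] and [tail (-1)] dominate the indicators of upward and downward deviations: a union
   bound. *)
apply: (@le_trans _ _
    (walk P f k (fun t => 1 + (-1) * (tail 1 t + tail (-1) t)) 0)).
  rewrite walkD walk1 walkZ walkD.
  have tail_le s : `|s| = 1 ->
      walk P f k (tail s) 0 <= expR (- (k%:R * e ^+ 2 / 8)).
    move=> s1; apply: le_trans (walk_tail _ _ _) _.
      by rewrite normrM s1 mul1r ger0_norm /l; lra.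
    rewrite exprMn -(@real_normK _ s) ?num_real // s1 /c /l.
    by rewrite le_eqVlt; apply/orP; left; apply/eqP; congr expR; field.
  have := tail_le 1 (normr1 _).
  have := tail_le (-1) (normrN1 _).
  by lra.
apply: le_walk => t; case: (lerP `|t / k%:R - mu|%R e); last first.
  rewrite ltr_normr => /orP h.
  have : 1 <= tail 1 t + tail (-1) t.
    case: h => h; [apply: ler_wpDr|apply: ler_wpDl] => //;
    rewrite /tail -expRD -[leLHS]expR0 ler_expR.
      suff : 0 <= l * (t - k%:R * mu - k%:R * e) by rewrite /c; lra.
      rewrite mulr_ge0 //; first by rewrite /l; lra.
      by move: h; rewrite ltrBrDr ltr_pdivlMr //; lra.
    suff : 0 <= l * (k%:R * mu - t - k%:R * e) by rewrite /c; lra.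
    rewrite mulr_ge0 //; first by rewrite /l; lra.
    by move: h; rewrite opprB ltrBrDl -ltrBrDr ltr_pdivrMr //; lra.
  by rewrite mulr0n; lra.
by move=> _; rewrite mulr1n; have := tail_ge0 1 t; have := tail_ge0 (-1) t; lra.
Qed.

End Chernoff.

(** * The program and its execution *)

(* r_0: samples so far, r_1: number of samples, r_2: 1, r_3: sum of the gains;
   line 6 is an unconditional jump, since r_0 < r_1 inside the loop. *)
Definition estimator (m : nat) : program :=
  [:: Const 1 m; Const 2 1;
      SampleP 0; CallP 4 0; CallQ 5 0; JumpLt 5 4 7; JumpLt 0 1 10;
      Div 6 5 4; Defs.Sub 6 2 6; Add 3 3 6;
      Add 0 0 2; JumpLt 0 1 2;
      Div 3 3 1; Output 3].

Section Run.
Variables (R : realType) (U : finType) (P Q : fdist R U) (CP CQ : circuit R U).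
Hypothesis CQ_ge0 : forall x, 0 <= cval CQ x.
Let T := max_time CP CQ.
Let f x := gain (cval CP x) (cval CQ x).

Lemma ctime_le x : (ctime CP x <= T)%N /\ (ctime CQ x <= T)%N.
Proof.
have h : (maxn (ctime CP x) (ctime CQ x) <= T)%N.
  by rewrite /T /max_time (leq_bigmax (F := fun x => maxn (ctime CP x) (ctime CQ x))).
by move: h; rewrite geq_max => /andP.
Qed.

(** [k] counts the turns left. The loop test comes last, so with no turn left control is at the
    final division. *)
Definition loop_state (m k : nat) (S : R) (s : state R U) : Prop :=
  [/\ pc s = (if k is 0 then 12 else 2)%N, reg s 0%N = (m - k)%:R,
      reg s 1%N = m%:R, reg s 2%N = 1 & reg s 3%N = S].

(** A turn takes 7 instructions without gain and 9 with one, so [V] must not depend on the exact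
    number [n'] of steps left. The clock grows by at most 9 plus the two calls. *)
Lemma run_turn (m k n : nat) (S : R) (s : state R U) (E : pred (outcome R))
    (V : U -> R) :
  (k < m)%N -> (9 <= n)%N -> loop_state m k.+1 S s ->
  (forall x n' s', (n <= n' + 9)%N -> loop_state m k (S + f x) s' ->
    drawsP s' = (drawsP s).+1 -> (clock s' <= clock s + 2 * T + 9)%N ->
    Pr_from P Q CP CQ (estimator m) n' s' E = V x) ->
  Pr_from P Q CP CQ (estimator m) n s E = \sum_x P x * V x.
Proof.
case: s => [p r it dr ck] km n9 [/= -> r0 r1 r2 r3] HV.
do 7 (case: n n9 HV => [|n] n9 HV; first by lia); rewrite /=.
apply: eq_bigr => x _; congr (_ * _).
have [TP TQ] := ctime_le x.
have r0m : r 0%N < r 1%N by rewrite r0 r1 ltr_nat; lia.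
have next : (m - k.+1)%:R + 1 = (m - k)%:R :> R by rewrite natr1; congr (_%:R); lia.
have cont : ((m - k)%:R < m%:R :> R) = (0 < k)%N by rewrite ltr_nat; lia.
rewrite /step /=; case: (ltP (cval CQ x) (cval CP x)) => hx /=.
  have CPx : cval CP x == 0 = false by apply/eqP => e; move: (CQ_ge0 x); lra.
  do 2 (case: n n9 HV => [|n] n9 HV; first by lia).
  rewrite /= CPx /=; apply: HV => //=; try lia.
  split => //=; rewrite ?r0 ?r1 ?r2 ?r3 ?next ?cont ?/f ?/gain ?hx //.
  by case: (k).
rewrite r0m /=.
apply: HV => //=; try lia.
split => //=; rewrite ?r0 ?r1 ?r2 ?r3 ?next ?cont //; first by case: (k).
by rewrite /f /gain ltNge hx addr0.
Qed.

(** Every run stays within [d] and [t], so one statement serves both claims: [g] is the indicator of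
    an accurate answer, or constantly 1 for the resource bounds. *)
Lemma run_loop (m : nat) (E : pred (outcome R)) (g : R -> R) (d t : nat) :
  (0 < m)%N ->
  (forall o, (samplesP o <= d)%N -> (runtime o <= t)%N -> (E o)%:R = g (answer o)) ->
  forall k n S s, (k <= m)%N -> (9 * k + 2 <= n)%N -> loop_state m k S s ->
  (drawsP s + k <= d)%N -> (clock s + k * (2 * T + 9) + 2 <= t)%N ->
  Pr_from P Q CP CQ (estimator m) n s E =
  walk P f k (fun S => g (S / m%:R)) S.
Proof.
move=> m0 Eg; elim=> [|k IH] n S s km kn ls dd tt.
  case: s ls dd tt => [p r it dr ck] [/= -> _ r1 _ r3] dd tt.
  case: n kn => [|[|n]] //= _.
  have mn0 : m%:R == 0 :> R = false by rewrite pnatr_eq0; lia.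
  by rewrite /step /= r1 mn0 /= r3 Eg //=; lia.
apply: (run_turn (n := n) km _ ls); first by lia.
move=> x n' s' nn' ls' dr' ck'; apply: IH => //; lia.
Qed.

Lemma run_estimator (m n : nat) (E : pred (outcome R)) (g : R -> R) :
  (0 < m)%N -> (9 * m + 4 <= n)%N ->
  (forall o, (samplesP o <= m)%N -> (runtime o <= m * (2 * T + 9) + 4)%N ->
    (E o)%:R = g (answer o)) ->
  Pr P Q CP CQ (estimator m) n E = walk P f m (fun S => g (S / m%:R)) 0.
Proof.
move=> m0 + Eg; case: n => [|[|n]] hn; try by lia.
rewrite /Pr /=; apply: (run_loop m0 Eg) => //=; try lia.
by split => //=; [case: (m) m0|rewrite subnn].
Qed.

End Run.

(** * Choice of constants and conclusion *)

Lemma ln2_ge (R : realType) : 2^-1 <= ln (2 : R).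
Proof.
have h : -1 < - 2^-1 :> R by lra.
have := le_ln1Dx h.
have -> : 1 + - 2^-1 = 2^-1 :> R by lra.
by rewrite lnV ?posrE //; lra.
Qed.

Lemma runtime_bound (m T : nat) :
  (0 < m)%N -> (0 < T)%N -> (m * (2 * T + 9) + 4 <= 15 * m * T)%N.
Proof. by move=> m0 T0; have := leq_pmulr m T0; lia. Qed.

Unset Implicit Arguments.

Theorem theorem3p1 (R : realType) :
  exists K : R, forall eps delta : R, 0 < eps -> 0 < delta ->
  exists A : program,
  forall (U : finType) (P Q : fdist R U) (CP CQ : circuit R U)
    (beta gamma : R),
  gamma < 1 ->
  eval_approximator beta gamma P (cval CP) ->
  eval_approximator beta gamma Q (cval CQ) ->
  exists n : nat,
    1 - delta <=
      Pr P Q CP CQ A n (fun o =>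
        `|answer o - dTV P Q| <= 2 * gamma / (1 - gamma) + 3 * beta + eps)
    /\
    Pr P Q CP CQ A n (fun o =>
        ((samplesP o)%:R <= K * rate eps delta) &&
        ((runtime o)%:R <= K * rate eps delta * (max_time CP CQ)%:R)) = 1.
Proof.
(* [270 = 15 * 18]: the run takes time at most [15 * m * T], with [m <= 18 * r]. *)
exists 270 => eps delta eps0 delta0.
pose e := Num.min eps 1; pose dl := Num.min delta 2^-1.
have e01 : 0 < e <= 1 by rewrite /e lt_min eps0 ltr01 ge_min lexx orbT.
have dl0 : 0 < dl by rewrite /dl lt_min delta0 invr_gt0 ltr0n.
have dl2 : dl <= 2^-1 by rewrite /dl ge_min lexx orbT.
have ln_dl : ln (2 : R) <= ln dl^-1.
  by rewrite ler_ln ?posrE ?invr_gt0 // -[leLHS]invrK lef_pV2 ?posrE ?invr_gt0.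
have ln2 := ln2_ge R.
have ee : 0 < e ^+ 2 <= 1 by case/andP: e01 => ? ?; rewrite exprn_gt0 // exprn_ile1 // ltW.
have rE : rate eps delta * e ^+ 2 = ln dl^-1.
  by rewrite /rate -/e -/dl mulrAC mulVf ?mul1r // gt_eqF //; case/andP: ee.
have r_ge : 2^-1 <= rate eps delta.
  apply: (@le_trans _ _ (rate eps delta * e ^+ 2)); first by rewrite rE; lra.
  have r0 : 0 <= rate eps delta.
    by rewrite -(pmulr_lge0 _ (proj1 (andP ee))) rE; lra.
  by rewrite ler_piMr //; case/andP: ee.
set r := rate eps delta in rE r_ge *.
(* The rounding costs at most 1, which is at most [2 * r] because [r >= 2^-1]. *)
pose m := (Num.truncn (16 * r)).+1.
have m_gt : 16 * r < m%:R by rewrite /m truncnS_gt.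
have m_le : m%:R <= 18 * r.
  have h : (Num.truncn (16 * r))%:R <= 16 * r by rewrite truncn_le //; lra.
  by rewrite /m -natr1; lra.
have m0 : (0 < m)%N by [].
clearbody m; exists (estimator m) => U P Q CP CQ beta gamma g1 hP hQ.
have CP0 x : 0 <= cval CP x by case: hP => /(_ x)/andP[].
have CQ0 x : 0 <= cval CQ x by case: hQ => /(_ x)/andP[].
exists (9 * m + 4)%N; split; last first.
  rewrite (run_estimator _ _ CQ0 (g := fun=> 1) m0 (leqnn _)) ?walk1 // => o so ro.
  (* Mass 1 makes [U] nonempty, and every call takes positive time. *)
  have T0 : (0 < max_time CP CQ)%N.
    case: (pickP (fun _ : U => true)) => [x _|U0].
      exact: leq_trans (ctime_gt0 CP x) (proj1 (ctime_le CP CQ x)).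
    by have /eqP := pmf_sum1 P; rewrite big1 ?(eq_sym 0) ?oner_eq0 // => x; have := U0 x.
  have sm : (samplesP o)%:R <= m%:R :> R by rewrite ler_nat.
  have rm : (runtime o)%:R <= 15 * m%:R * (max_time CP CQ)%:R :> R.
    rewrite -!natrM ler_nat; apply: leq_trans ro _; exact: runtime_bound.
  rewrite (_ : _ && _ = true) //; apply/andP; split; first by lra.
  apply: le_trans rm _; rewrite ler_wpM2r //; lra.
pose g a : R := (`|a - \sum_x P x * gain (cval CP x) (cval CQ x)| <= e)%R%:R.
rewrite (run_estimator _ _ CQ0 (g := fun a =>
  (`|a - dTV P Q| <= 2 * gamma / (1 - gamma) + 3 * beta + eps)%R%:R) m0 (leqnn _)) //.
have f01 x : 0 <= gain (cval CP x) (cval CQ x) <= 1 by exact: gain_itv.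
apply: (@le_trans _ _ (walk P (fun x => gain (cval CP x) (cval CQ x)) m
                        (fun t => g (t / m%:R)) 0)); last first.
  apply: le_walk => t; rewrite /g.
  case: (lerP _ e) => [h|_]; last by rewrite mulr0n ler0n.
  suff -> : `|t / m%:R - dTV P Q| <= 2 * gamma / (1 - gamma) + 3 * beta + eps by [].
  apply: le_trans (ler_distD (\sum_x P x * gain (cval CP x) (cval CQ x)) _ _) _.
  have := gain_bias g1 hP hQ.
  have : e <= eps by rewrite /e ge_min lexx.
  by lra.
apply: (@le_trans _ _ (1 - 2 * expR (- (m%:R * e ^+ 2 / 8)))); last first.
  exact: walk_concentration.
have dd : dl <= delta by rewrite /dl ge_min lexx.
(* The factor 16 in [m] makes the left side at most [dl ^+ 2], and [dl <= 2^-1]. *)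
suff : expR (- (m%:R * e ^+ 2 / 8)) <= dl / 2 by lra.
rewrite -[leRHS]lnK ?posrE ?divr_gt0 // ler_expR ln_div ?posrE //.
have me : 16 * ln dl^-1 <= m%:R * e ^+ 2.
  by rewrite -rE mulrA ler_wpM2r ?sqr_ge0 // ltW.
by rewrite lnV ?posrE // in ln_dl me; lra.
Qed.
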